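(* Let $p \geq 1$ be an integer and let $\tau:\mathbb{N}\to\mathbb{N}\cup\{0\}$ be an admissible tau-function. Then $\tau$ has period $p$ if and only if $\tau(n) = n-p$ for all $n\in\mathbb{N}$ with $n \geq 2p-2$.
   Context: $\mathbb{N}=\{1,2,3,\dots\}$. A function $\tau:\mathbb{N}\to\mathbb{N}\cup\{0\}$ (infinite length) or $\tau:\{1,\dots,N\}\to\mathbb{N}\cup\{0\}$ (length $N$) is an admissible tau-function if the following hold, whenever the values of $\tau$ involved are defined: (A) $\tau(1)=0$. (B) $\tau(n+1)\le\tau(n)+1$. (From (A),(B), $\tau(n)<n$, so for each $n\geq 1$ there is a unique integer $\operatorname{ord}(n)\ge 1$ such that the iterate $\tau^{\operatorname{ord}(n)}(n)=0$.) (C) If $\tau(n+1)<\tau^k(n)+1$ for some $0<k<\operatorname{ord}(n)$, then $\tau(n+1)\le\tau^{k+1}(n)+1$. (D) If $\tau(n+1)<\tau^k(n)+1$ for some $0<k<\operatorname{ord}(n)$, and if $\tau(\tau^k(n)+1)=\tau^{k+1}(n)+1$, then $\tau(n+1)<\tau^{k+1}(n)+1$. (E) If $\operatorname{ord}(n)>1$ and $\operatorname{ord}(\tau^{\operatorname{ord}(n)-1}(n)+1)=1$, then $\tau(n+1)\neq 0$. An admissible tau-function $\tau:\mathbb{N}\to\mathbb{N}\cup\{0\}$ is periodic with period $p$ if there exists $N(\tau)\in\mathbb{N}$ such that $\tau(n)=n-p$ for all $n\ge N(\tau)$. *)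

(* Defs.v *)
From mathcomp Require Import all_boot all_order all_algebra.

Set Implicit Arguments.
Unset Strict Implicit.
Unset Printing Implicit Defensive.

(* An infinite sequence on {1, 2, 3, ...} is a function tau : nat -> nat whose
   value at 0 is irrelevant: nothing below depends on [tau 0]. *)

(* For 0 < n this is the least k with tau^k(n) = 0, provided there is one with
   k <= n.  Beyond it tau^k(n) is undefined in the paper, as 0 is not in the
   domain of tau, so the least such k is the only meaningful one. *)
Definition ord (tau : nat -> nat) (n : nat) : nat :=
  find (fun k => iter k tau n == 0) (iota 0 n.+1).

Record admissible (tau : nat -> nat) : Prop := Admissible {
  admA : tau 1 = 0;
  admB : forall n, 0 < n -> tau n.+1 <= (tau n).+1;
  admC : forall n k, 0 < n -> 0 < k < ord tau n ->
    tau n.+1 < (iter k tau n).+1 ->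
    tau n.+1 <= (iter k.+1 tau n).+1;
  admD : forall n k, 0 < n -> 0 < k < ord tau n ->
    tau n.+1 < (iter k tau n).+1 ->
    tau (iter k tau n).+1 = (iter k.+1 tau n).+1 ->
    tau n.+1 < (iter k.+1 tau n).+1;
  admE : forall n, 0 < n -> 1 < ord tau n ->
    ord tau (iter (ord tau n).-1 tau n).+1 = 1 ->
    tau n.+1 <> 0
}.

Definition has_period (tau : nat -> nat) (p : nat) : Prop :=
  exists2 N : nat, 0 < N &
    forall n : nat, N <= n -> ((tau n)%:Z = n%:Z - p%:Z)%R.

Lemma tau_lt (tau : nat -> nat) :
  tau 1 = 0 -> (forall n, 0 < n -> tau n.+1 <= (tau n).+1) ->
  forall n, 0 < n -> tau n < n.
Proof.
move=> A B; elim=> [//|[_ _|n IHn _]]; first by rewrite A.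
by apply: leq_ltn_trans (B n.+1 isT) _; rewrite ltnS; apply: IHn.
Qed.

(* (A) and (B) alone make [ord] meaningful at every positive n. *)
Lemma ordP (tau : nat -> nat) :
  tau 1 = 0 -> (forall n, 0 < n -> tau n.+1 <= (tau n).+1) ->
  forall n, 0 < n ->
  [/\ 0 < ord tau n, iter (ord tau n) tau n = 0
    & forall k, k < ord tau n -> 0 < iter k tau n].
Proof.
move=> A B n n0; pose P k := iter k tau n == 0.
have hasP : has P (iota 0 n.+1).
  apply/negPn/negP=> /hasPn noP.
  have pos k : k <= n -> 0 < iter k tau n.
    by move=> kn; rewrite lt0n; apply: noP; rewrite mem_iota.
  have le k : k <= n -> iter k tau n + k <= n.
    elim: k => [|k IHk] kn; first by rewrite addn0.
    apply: leq_trans (IHk (ltnW kn)).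
    by rewrite addnS -addSn leq_add2r; apply: (tau_lt A B); apply/pos/ltnW.
  by move: (le n (leqnn n)); rewrite leqNgt -[X in X < _]add0n ltn_add2r pos.
have lt_ord : ord tau n < n.+1 by rewrite -[n.+1](size_iota 0) -has_find.
have zero : iter (ord tau n) tau n = 0.
  by apply/eqP; have := nth_find 0 hasP; rewrite nth_iota.
split=> // [|k k_lt].
  by rewrite lt0n; apply/eqP=> o0; move: zero n0; rewrite o0 /= => ->.
have := before_find 0 k_lt; rewrite nth_iota ?add0n; last exact: ltn_trans lt_ord.
by rewrite lt0n => ->.
Qed.

(* Main.v *)
Require Import Defs.
From mathcomp Require Import all_boot all_order all_algebra.
From mathcomp Require Import zify.

Set Implicit Arguments.
Unset Strict Implicit.
Unset Printing Implicit Defensive.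

(** An admissible tau-function behaves like the longest-border function of a
    word, the descendants tau n, tau (tau n), ... of n being the borders of the
    prefix of length n; n - b is then a period of that prefix.  The core is a
    Fine-Wilf property ([desc_fine_wilf]): if the periods n - a and n - b have
    sum at most n + 1, then one extends to n + 1 exactly when the other does.
    If tau n = n - p for large n but not from 2 p - 2 on, the last failure n has
    the periods n - tau n < p and p, of which only p extends to n + 1, although
    their sum is at most 2 p - 1 <= n + 1. *)

(* Unlike [iter k tau n = b], this never iterates through the junk value of
   tau at 0. *)
Inductive desc (tau : nat -> nat) : nat -> nat -> Prop :=
| desc_tau n : 0 < n -> desc tau (tau n) n
| desc_step b n : 0 < n -> desc tau b (tau n) -> desc tau b n.

Lemma desc_gt0 tau b n : desc tau b n -> 0 < n.
Proof. by case. Qed.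

Lemma desc_trans tau a b n : desc tau a b -> desc tau b n -> desc tau a n.
Proof.
move=> ab db; elim: db ab => [m m0 //|c m m0 _ IH] ab.
  exact: desc_step.
by apply: desc_step => //; apply: IH.
Qed.

Lemma desc_iter tau b n : desc tau b n ->
  exists2 k, 0 < k & iter k tau n = b /\ forall j, j < k -> 0 < iter j tau n.
Proof.
elim=> [m m0|c m m0 _ [k k0 [kE kpos]]].
  by exists 1 => //; split=> // -[].
exists k.+1 => //; split; first by rewrite iterSr.
by case=> [|j] //; rewrite ltnS iterSr => /kpos.
Qed.

Section Admissible.
Variables (tau : nat -> nat) (htau : admissible tau).

Lemma adm_lt n : 0 < n -> tau n < n.
Proof. exact: (tau_lt (admA htau) (admB htau)). Qed.

Lemma desc_lt b n : desc tau b n -> b < n.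
Proof.
elim=> [m /adm_lt //|c m m0 _ IH].
exact: ltn_trans IH (adm_lt m0).
Qed.

Lemma desc_le b n : desc tau b n -> b <= tau n.
Proof. by case=> [//|c m _ /desc_lt /ltnW]. Qed.

Lemma desc_chain a b n : desc tau a n -> desc tau b n -> b < a -> desc tau b a.
Proof.
elim=> [m m0 db|c m m0 dc IH db] lt_b.
  by case: db lt_b => // k; rewrite ltnn.
apply: IH => //; case: db dc lt_b => // k k0 /desc_lt; lia.
Qed.

Lemma desc_iter_lt_ord m n : desc tau m n -> 0 < m ->
  exists2 k, 0 < k < ord tau n & iter k tau n = m.
Proof.
move=> d m0; have [k k0 [kE kpos]] := desc_iter d.
exists k => //; rewrite k0 ltnNge; apply/negP => le_ord.
have [_ zero _] := ordP (admA htau) (admB htau) (desc_gt0 d).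
move: le_ord; rewrite leq_eqVlt => /orP[/eqP e|/kpos]; last by rewrite zero.
by move: m0; rewrite -kE -e zero.
Qed.

Lemma desc_admC m n : desc tau m n -> 0 < m ->
  tau n.+1 < m.+1 -> tau n.+1 <= (tau m).+1.
Proof.
move=> d m0; have [k kord <-] := desc_iter_lt_ord d m0.
exact: admC htau _ _ (desc_gt0 d) kord.
Qed.

Lemma desc_admD m n : desc tau m n -> 0 < m ->
  tau n.+1 < m.+1 -> tau m.+1 = (tau m).+1 -> tau n.+1 < (tau m).+1.
Proof.
move=> d m0; have [k kord <-] := desc_iter_lt_ord d m0.
exact: admD htau _ _ (desc_gt0 d) kord.
Qed.

(** By (C) the chain of descendants of [n] cannot jump over [b]: each of them exceeding [b] has
    [tau] at least [b]. *)
Lemma desc_tau_pred n b : 0 < n -> tau n.+1 = b.+1 -> desc tau b n.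
Proof.
move=> n0 e.
suff H m : desc tau m n -> b <= m -> desc tau b n.
  by apply: (H _ (desc_tau tau n0)); have := admB htau n0; rewrite e.
elim/ltn_ind: m => m IH dm; rewrite leq_eqVlt => /orP[/eqP -> //|lt_bm].
have m0 : 0 < m by lia.
apply: (IH (tau m) (adm_lt m0)); first exact: desc_trans (desc_tau tau m0) dm.
by have := desc_admC dm m0; rewrite e !ltnS; apply.
Qed.

Lemma desc_pred b n : desc tau b.+1 n.+1 -> desc tau b n.
Proof.
elim/ltn_ind: n => n IH d.
have n0 : 0 < n by have := desc_lt d; lia.
have := desc_le d; case E : (tau n.+1) => [//|v] le_bv.
have dv := desc_tau_pred n0 E.
move: le_bv; rewrite leq_eqVlt => /orP[/eqP[->] //|lt_bv].
apply: (desc_trans _ dv); apply: (IH v (desc_lt dv)).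
by apply: (desc_chain _ d lt_bv); rewrite -E; apply: desc_tau.
Qed.

(** In terms of periods: the period [n - b] passes from a prefix to a shorter one. *)
Lemma desc_sub j b n : desc tau (b + j) (n + j) -> desc tau b n.
Proof. by elim: j => [|j IH]; rewrite ?addn0 // !addnS => /desc_pred. Qed.

(* A form of (D) in which m + 1 may descend from n + 1 in several steps. *)
Lemma desc_succ m n : desc tau m n -> 0 < m -> tau m.+1 = (tau m).+1 ->
  desc tau (tau m).+1 n.+1 -> desc tau m.+1 n.+1.
Proof.
move=> + m0 mE; elim/ltn_ind: n => n IH dm dt.
have n0 := desc_gt0 dm; have t_m := adm_lt m0.
have dn : desc tau (tau n.+1) n.+1 by apply: desc_tau.
case: (ltngtP (tau n.+1) m.+1) => [lt_m|gt_m|<- //].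
  (* (D) would put the largest descendant of [n.+1] below the descendant [(tau m).+1]. *)
  by have := desc_admD dm m0 lt_m mE; have := desc_le dt; lia.
case E : (tau n.+1) gt_m dn => [//|v] gt_m dn.
have dv := desc_tau_pred n0 E.
apply: (desc_trans _ dn); apply: (IH v (desc_lt dv)).
  exact: desc_chain dv dm _.
by apply: desc_chain dn dt _; lia.
Qed.

Lemma desc_fine_wilf n a b : desc tau a n -> desc tau b n -> b < a ->
  n <= a + b + 1 -> desc tau a.+1 n.+1 <-> desc tau b.+1 n.+1.
Proof.
elim/ltn_ind: n a b => n FW a b da db lt_ba le_n.
have lt_an := desc_lt da; have dba := desc_chain da db lt_ba.
(* The period n - a of n is also a period of a, and it extends to a + 1 since
   a + 1 <= n; by induction so does the period a - b. *)
have da2 : desc tau (a - (n - a)) a.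
  by apply: (@desc_sub (n - a)); have [-> ->] : a - (n - a) + (n - a) = a /\
    a + (n - a) = n by lia.
have da2S : desc tau (a - (n - a)).+1 a.+1.
  by apply: (@desc_sub (n - a).-1);
    have [-> ->] : (a - (n - a)).+1 + (n - a).-1 = a /\
      a.+1 + (n - a).-1 = n by lia.
have dbaS : desc tau b.+1 a.+1.
  case: (ltngtP (a - (n - a)) b) => [lt|gt|<- //].
    by apply/(FW a lt_an _ _ dba da2 lt) => //; lia.
  by apply/(FW a lt_an _ _ da2 dba gt) => //; lia.
split=> [|dbS]; first exact: desc_trans.
(* [desc_succ] transfers the property of descending from n + 1 up the chain
   from b + 1 to a + 1; along it every c has tau (c + 1) = tau c + 1. *)
have step c : desc tau c n -> desc tau b c -> desc tau b.+1 c.+1 ->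
    c <= b + tau c + 1 -> desc tau c.+1 n.+1.
  elim/ltn_ind: c => c IH dc dbc dbcS le_c.
  have lt_cn := desc_lt dc; have c0 := desc_gt0 dbc.
  have dtc := desc_tau tau c0; have lt_tc := adm_lt c0.
  have dtcS : desc tau (tau c).+1 c.+1.
    have := desc_le dbc; rewrite leq_eqVlt => /orP[/eqP <- //|lt_b].
    by apply/(FW c lt_cn _ _ dtc dbc lt_b) => //; lia.
  have tcS : tau c.+1 = (tau c).+1.
    by have := desc_le dtcS; have := admB htau c0; lia.
  have dtn : desc tau (tau c).+1 n.+1.
    have := desc_le dbc; rewrite leq_eqVlt => /orP[/eqP <- //|lt_b].
    (* The period [c - tau c] of [c] is also one of [tau c]; this bounds [tau (tau c)] from below,
       just enough to carry [le_c] over to [tau c]. *)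
    have dtc2 : desc tau (tau c - (c - tau c)) (tau c).
      apply: (@desc_sub (c - tau c)).
      by have [-> ->] : tau c - (c - tau c) + (c - tau c) = tau c /\
        tau c + (c - tau c) = c by lia.
    apply: (IH _ lt_tc) => //.
    - exact: desc_trans dtc dc.
    - exact: desc_chain dtc dbc lt_b.
    - exact: desc_chain dtcS dbcS _.
    - by have := desc_le dtc2; lia.
  exact: desc_succ.
by apply: step => //; have := desc_le da2; lia.
Qed.

End Admissible.

Theorem theorem2p1 (p : nat) (hp : 1 <= p) (tau : nat -> nat)
    (htau : admissible tau) :
  has_period tau p <->
  (forall n : nat, 0 < n -> 2 * p - 2 <= n -> ((tau n)%:Z = n%:Z - p%:Z)%R).
Proof.
split=> [[N N0 per]|per]; last first.
  by exists (2 * p) => [|n le_n]; [lia | apply: per; lia].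
have back n : 0 < n -> 2 * p - 2 <= n -> tau n.+1 + p = n.+1 -> tau n + p = n.
  move=> n0 le_n e; have leB := admB htau n0.
  case: (ltngtP (tau n + p) n) => [|lt_n|//]; first by lia.
  (* Here [p <= n]: by [0 < n] if [p = 1], by [2 * p - 2 <= n] otherwise. *)
  have E : tau n.+1 = (n - p).+1 by lia.
  have dp := desc_tau_pred htau n0 E.
  have /(desc_le htau) : desc tau (tau n).+1 n.+1.
    apply/(desc_fine_wilf htau (desc_tau tau n0) dp); try lia.
    by rewrite -E; apply: desc_tau.
  by lia.
(* Downward induction from [N], with [j] bounding the distance from [n] up to [N]. *)
suff H j n : 0 < n -> 2 * p - 2 <= n -> N <= n + j -> tau n + p = n.
  by move=> n n0 le_n; have := H N n n0 le_n (leq_addl _ _); lia.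
elim: j n => [|j IH] n n0 le_n le_N.
  by have := per n; rewrite -[n]addn0 le_N => /(_ isT); lia.
by apply: back => //; apply: IH; lia.
Qed.
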